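(* For all integers $\alpha\ge 1$ and $n\ge 0$, $\overline{p}_3\big(3^{2\alpha+1}(3n+2)\big)\equiv 0\pmod{144}$.
   Context: An overpartition of $n$ is a partition of $n$ in which the first occurrence of each distinct part may (or may not) be overlined. An overpartition triple of $n$ is a triple of overpartitions whose parts together sum to $n$. $\overline{p}_3(n)$ denotes the number of overpartition triples of $n$, with $\overline{p}_3(0)=1$; equivalently $\sum_{n\ge0}\overline{p}_3(n)q^n=\big((-q;q)_\infty/(q;q)_\infty\big)^3$, where $(a;q)_\infty=\prod_{n\ge0}(1-aq^n)$. *)

(* Defs.v *)
From mathcomp Require Import all_boot.

Set Implicit Arguments.
Unset Strict Implicit.
Unset Printing Implicit Defensive.

(* A list of parts, each with a flag telling whether it is overlined. The parts
   are positive and nonincreasing; the last clause says that a part equal to an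
   earlier one is not overlined, i.e. only a first occurrence may be. *)
Definition overpartition (s : seq (nat * bool)) : bool :=
  [&& sorted geq (unzip1 s), all (fun x => 0 < x.1) s
    & pairwise (fun x y => (x.1 == y.1) ==> ~~ y.2) s].

Definition weight (s : seq (nat * bool)) : nat := sumn (unzip1 s).

Definition overpartition_triple (n : nat)
    (t : seq (nat * bool) * seq (nat * bool) * seq (nat * bool)) : bool :=
  [&& overpartition t.1.1, overpartition t.1.2, overpartition t.2
    & weight t.1.1 + weight t.1.2 + weight t.2 == n].

(* In a triple of total weight n every list has at most n entries, all of them
   at most n, so all triples of weight n live in a finite type; see p3barE. *)
Definition bounded_list (n : nat) : finType := n.-bseq ('I_n.+1 * bool)%type.

Definition to_list (n : nat) (s : bounded_list n) : seq (nat * bool) :=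
  [seq (val x.1, x.2) | x <- (s : n.-bseq ('I_n.+1 * bool))].

Definition to_triple (n : nat)
    (t : bounded_list n * bounded_list n * bounded_list n) :=
  (to_list t.1.1, to_list t.1.2, to_list t.2).

Definition p3bar (n : nat) : nat :=
  #|[set t : bounded_list n * bounded_list n * bounded_list n
      | overpartition_triple n (to_triple t)]|.

Lemma to_list_inj n : injective (@to_list n).
Proof.
move=> s t /inj_map eq_st; apply/val_inj/eq_st.
by move=> [i b] [j c] /= [/val_inj -> ->].
Qed.

Lemma to_triple_inj n : injective (@to_triple n).
Proof.
move=> [[a b] c] [[a' b'] c'] [] /to_list_inj -> /to_list_inj -> /to_list_inj.
by move=> ->.
Qed.

Lemma size_weight s : all (fun x => 0 < x.1) s -> size s <= weight s.
Proof.
elim: s => //= x s IHs /andP[x_gt0 /IHs le_s].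
by rewrite /weight /= -add1n leq_add.
Qed.

Lemma part_weight s x : x \in s -> x.1 <= weight s.
Proof.
elim: s => //= y s IHs; rewrite inE /weight /= => /predU1P[-> | /IHs].
  exact: leq_addr.
by move/leq_trans; apply; apply: leq_addl.
Qed.

Lemma to_list_surj n s :
  overpartition s -> weight s <= n -> exists t : bounded_list n, to_list t = s.
Proof.
case/and3P=> _ s_gt0 _ le_sn.
have sz_s : size [seq (inord x.1 : 'I_n.+1, x.2) | x <- s] <= n.
  by rewrite size_map (leq_trans (size_weight s_gt0)).
exists (Bseq sz_s); rewrite /to_list /= -map_comp map_id_in // => -[i b] /= s_ib.
by rewrite inordK // ltnS (leq_trans (part_weight s_ib)).
Qed.

(* The size bounds in p3bar lose nothing: p3bar n is the length of any
   duplicate-free list of all overpartition triples of n. *)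
Lemma p3barE n l :
  uniq l -> (forall t, (t \in l) = overpartition_triple n t) ->
  p3bar n = size l.
Proof.
move=> l_uniq lP; rewrite /p3bar cardE -(size_map (@to_triple n)).
apply/perm_size/uniq_perm => //.
  by rewrite map_inj_uniq ?enum_uniq //; apply: to_triple_inj.
move=> t; rewrite lP; apply/mapP/idP => [[u] | t_ok].
  by rewrite mem_enum inE => ? ->.
have /and4P[ok1 ok2 ok3 /eqP wt] := t_ok.
have [a ea] : exists a : bounded_list n, to_list a = t.1.1.
  by apply: to_list_surj; rewrite // -wt -addnA leq_addr.
have [b eb] : exists b : bounded_list n, to_list b = t.1.2.
  by apply: to_list_surj; rewrite // -wt addnAC leq_addl.
have [c ec] : exists c : bounded_list n, to_list c = t.2.
  by apply: to_list_surj; rewrite // -wt leq_addl.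
have et : t = to_triple (a, b, c).
  by rewrite /to_triple /= ea eb ec; case: t {lP t_ok ok1 ok2 ok3 wt ea eb ec} => [[]].
by exists (a, b, c); rewrite // mem_enum inE -et.
Qed.

(* Main.v *)
(* Let theta = \sum_(k : int) (-1) ^ k X ^ (k ^ 2). Gauss's product for theta shows
   that its inverse generates the overpartitions, so P = theta ^- 3 generates the
   overpartition triples.

   Modulo 16, with theta = 1 + 2 S, we have P = 1 - 6 S + 8 S ^ 2, and a number
   whose 3-adic valuation is odd is neither a square nor a sum of two squares.

   Modulo 9, write V for X |-> X ^ 3 and U for the extraction of the coefficients
   of index divisible by 3. The dissection theta = V (V theta) + X * V c and the
   product formula give V theta * (V theta ^ 3 + X * c ^ 3) = theta ^ 4 and
   theta ^ 9 = V theta ^ 3. Hence U (U P) = V theta * theta ^ 2, and U exchanges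
   this series with V theta ^ 2 * theta, which has no exponent equal to 2 mod 3. *)
Require Import Defs.
From mathcomp Require Import all_boot.
From HB Require Import structures.
From mathcomp Require Import all_algebra boolp ring zify.

Set Implicit Arguments.
Unset Strict Implicit.
Unset Printing Implicit Defensive.

Import GRing.Theory.

(** * Formal power series *)

Section PowerSeries.
Local Open Scope ring_scope.
Variable R : comNzRingType.

Record fps := Fps {coefs :> nat -> R}.

Lemma fpsP (f g : fps) : f =1 g <-> f = g.
Proof. by case: f g => [f] [g]; split=> [/= /funext -> | ->]. Qed.

HB.instance Definition _ := gen_eqMixin fps.
HB.instance Definition _ := gen_choiceMixin fps.

Definition fps_add (f g : fps) := Fps (fun n => f n + g n).
Definition fps_opp (f : fps) := Fps (fun n => - f n).
Definition fps_zero := Fps (fun=> 0).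

Fact fps_addA : associative fps_add.
Proof. by move=> f g h; apply/fpsP=> n /=; rewrite addrA. Qed.
Fact fps_addC : commutative fps_add.
Proof. by move=> f g; apply/fpsP=> n /=; rewrite addrC. Qed.
Fact fps_add0 : left_id fps_zero fps_add.
Proof. by move=> f; apply/fpsP=> n /=; rewrite add0r. Qed.
Fact fps_addN : left_inverse fps_zero fps_opp fps_add.
Proof. by move=> f; apply/fpsP=> n /=; rewrite addNr. Qed.

HB.instance Definition _ :=
  GRing.isZmodule.Build fps fps_addA fps_addC fps_add0 fps_addN.

Definition fps_one := Fps (fun n => (n == 0)%:R).
Definition fps_mul (f g : fps) := Fps (fun n => \sum_(i < n.+1) f i * g (n - i)%N).

(** A coefficient of a product involves finitely many coefficients of the factors, so the ring laws
    are inherited from [{poly R}] through truncations. *)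
Let trunc n (f : fps) : {poly R} := \poly_(i < n.+1) f i.

Let trunc_mul m n f g :
  (n <= m)%N -> fps_mul f g n = (trunc m f * trunc m g)`_n.
Proof.
move=> le_nm; rewrite coefM; apply: eq_bigr => i _; rewrite !coef_poly.
have le_im : (i <= m)%N by apply: leq_trans le_nm; rewrite -ltnS.
by rewrite !ltnS le_im (leq_trans (leq_subr i n) le_nm).
Qed.

Fact fps_mulC : commutative fps_mul.
Proof. by move=> f g; apply/fpsP=> n; rewrite !(@trunc_mul n) // mulrC. Qed.

Fact fps_mulA : associative fps_mul.
Proof.
have mulE f g h n :
  fps_mul f (fps_mul g h) n = (trunc n f * (trunc n g * trunc n h))`_n.
  rewrite coefM; apply: eq_bigr => i _; rewrite coef_poly ltn_ord.
  by rewrite (@trunc_mul n) ?leq_subr.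
move=> f g h; apply/fpsP=> n.
by rewrite mulE [fps_mul (fps_mul _ _) _]fps_mulC mulE mulrA mulrC.
Qed.

Fact fps_mul1 : left_id fps_one fps_mul.
Proof.
move=> f; apply/fpsP=> n /=.
by rewrite big_ord_recl /= mul1r subn0 big1 ?addr0 // => i _; rewrite mul0r.
Qed.

Fact fps_mulDl : left_distributive fps_mul fps_add.
Proof.
move=> f g h; apply/fpsP=> n /=.
by rewrite -big_split; apply: eq_bigr => i _; rewrite mulrDl.
Qed.

Fact fps_one_neq0 : fps_one != 0.
Proof. by apply/eqP=> /fpsP/(_ 0)/eqP; rewrite /= oner_eq0. Qed.

HB.instance Definition _ := GRing.Zmodule_isComNzRing.Build fps
  fps_mulA fps_mulC fps_mul1 fps_mulDl fps_one_neq0.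

Lemma coefsD (f g : fps) n : (f + g) n = f n + g n. Proof. by []. Qed.
Lemma coefsN (f : fps) n : (- f) n = - f n. Proof. by []. Qed.
Lemma coefs1 n : (1 : fps) n = (n == 0)%:R. Proof. by []. Qed.
Lemma coefsM (f g : fps) n : (f * g) n = \sum_(i < n.+1) f i * g (n - i)%N.
Proof. by []. Qed.

Lemma coefsMn (f : fps) k n : (f *+ k) n = f n *+ k.
Proof. by elim: k => // k IHk; rewrite !mulrS coefsD IHk. Qed.

Lemma coefs_sum I (r : seq I) (F : I -> fps) n :
  (\sum_(i <- r) F i) n = \sum_(i <- r) F i n.
Proof. exact: (big_morph (fun f : fps => f n)). Qed.

Lemma fps_natr0 k : k%:R = 0 :> R -> k%:R = 0 :> fps.
Proof. by move=> k0; apply/fpsP=> n; rewrite coefsMn -mulr_natr k0 mulr0. Qed.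

Lemma coefsM0 (f g : fps) : (f * g) 0 = f 0 * g 0.
Proof. by rewrite coefsM big_ord1. Qed.

Lemma coefs_exp0 (f : fps) k : f 0 = 1 -> (f ^+ k) 0 = 1.
Proof. by move=> f0; elim: k => // k IHk; rewrite exprS coefsM0 f0 IHk mulr1. Qed.

Definition fpsX : fps := Fps (fun n => (n == 1)%:R).
Local Notation X := fpsX.

Lemma coefsXM (f : fps) n : (X * f) n = if n is n'.+1 then f n' else 0.
Proof.
rewrite coefsM big_ord_recl mul0r add0r; case: n => [|n]; first by rewrite big_ord0.
rewrite big_ord_recl /= mul1r subn1 /= big1 ?addr0 // => i _.
by rewrite mul0r.
Qed.

Lemma coefsXnM k (f : fps) n :
  (X ^+ k * f) n = if (k <= n)%N then f (n - k)%N else 0.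
Proof.
elim: k n => [|k IHk] n; first by rewrite mul1r subn0.
by rewrite exprS -mulrA coefsXM; case: n => // n; rewrite IHk.
Qed.

Lemma coefsXn k n : (X ^+ k) n = (n == k)%:R.
Proof.
rewrite -[X ^+ k]mulr1 coefsXnM coefs1 subn_eq0 eqn_leq.
by case: leqP; rewrite ?andbT ?andbF.
Qed.

(** Congruence modulo [X ^ n]. Infinite products are never formed: identities of series are proved
    modulo every power of [X] with finite products. *)
Definition eqmodX n (f g : fps) := forall i, (i < n)%N -> f i = g i.

Lemma eqmodX_all (f g : fps) : (forall n, eqmodX n f g) -> f = g.
Proof. by move=> eq_fg; apply/fpsP=> n; apply: (eq_fg n.+1). Qed.

Lemma eqmodXW m n f g : (m <= n)%N -> eqmodX n f g -> eqmodX m f g.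
Proof. by move=> le_mn eq_fg i lt_im; apply: eq_fg; apply: leq_trans le_mn. Qed.

Lemma eqmodX_refl n f : eqmodX n f f. Proof. by []. Qed.

Lemma eqmodX_sym n f g : eqmodX n f g -> eqmodX n g f.
Proof. by move=> eq_fg i /eq_fg. Qed.

Lemma eqmodX_trans n f g h : eqmodX n f g -> eqmodX n g h -> eqmodX n f h.
Proof. by move=> eq_fg eq_gh i lt_in; rewrite eq_fg ?eq_gh. Qed.

Lemma eqmodXD n f f' g g' :
  eqmodX n f f' -> eqmodX n g g' -> eqmodX n (f + g) (f' + g').
Proof. by move=> eq_f eq_g i lt_in; rewrite !coefsD eq_f ?eq_g. Qed.

Lemma eqmodXM n f f' g g' :
  eqmodX n f f' -> eqmodX n g g' -> eqmodX n (f * g) (f' * g').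
Proof.
move=> eq_f eq_g i lt_in; apply: eq_bigr => j _.
by rewrite eq_f ?eq_g //; apply: leq_ltn_trans lt_in; rewrite ?leq_subr // -ltnS.
Qed.

Lemma eqmodXX n k f g : eqmodX n f g -> eqmodX n (f ^+ k) (g ^+ k).
Proof. by move=> eq_fg; elim: k => // k IHk; rewrite !exprS; apply: eqmodXM. Qed.

Lemma eqmodXnM n k f : (n <= k)%N -> eqmodX n (X ^+ k * f) 0.
Proof. by move=> le_nk i lt_in; rewrite coefsXnM leqNgt (leq_trans lt_in). Qed.

(** Coefficient [i] of [d * f] is [f i] plus terms in lower coefficients of [f], so strong induction
    on [i] applies. *)
Lemma eqmodX_cancel n (d f g : fps) :
  d 0 = 1 -> eqmodX n (d * f) (d * g) -> eqmodX n f g.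
Proof.
move=> d0 eq_dfg; elim/ltn_ind => i IHi lt_in.
have := eq_dfg i lt_in; rewrite !coefsM !big_ord_recl d0 !mul1r !subn0.
rewrite [X in _ = _ + X](eq_bigr
  (fun j : 'I_i => d (lift ord0 j) * f (i - lift ord0 j)%N)).
  by move/addIr.
move=> j _; rewrite IHi ?(leq_ltn_trans (leq_subr _ _) lt_in) //.
by have := ltn_ord j; rewrite lift0; lia.
Qed.

End PowerSeries.

(** * Dissection modulo 3 *)

Section Dissection.
Local Open Scope ring_scope.
Variable R : comNzRingType.
Local Notation fps := (fps R).
Local Notation X := (fpsX R).

Definition expand3 (f : fps) : fps :=
  Fps (fun n => if (3 %| n)%N then f (n %/ 3)%N else 0).
Local Notation V := expand3.

Definition section3 r (f : fps) : fps := Fps (fun n => f (3 * n + r)%N).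
Local Notation U := section3.

Lemma expand3E f n : V f n = if (3 %| n)%N then f (n %/ 3)%N else 0.
Proof. by []. Qed.

Lemma section3E r f n : U r f n = f (3 * n + r)%N.
Proof. by []. Qed.

(** Meant for Cauchy products with a factor [V g]. Since [r < 3], the last multiple of 3 in the
    range is [3 * n]. *)
Lemma sum_multiples3 (F : nat -> R) n r :
  (r < 3)%N -> (forall i, ~~ (3 %| i)%N -> F i = 0) ->
  \sum_(i < (3 * n + r).+1) F i = \sum_(i < n.+1) F (3 * i)%N.
Proof.
move=> lt_r3 F0; rewrite -(big_mkord xpredT F) -(big_mkord xpredT (fun i => F (3 * i)%N)).
have ->: \sum_(0 <= i < (3 * n + r).+1) F i = \sum_(0 <= i < (3 * n).+1) F i.
  case: r lt_r3 => [|[|[|//]]] _; rewrite ?addn0 ?addn1 ?addn2 //.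
    by rewrite big_nat_recr //= F0 ?addr0 //; lia.
  by rewrite !(big_nat_recr (_.+1)) //= !F0 ?addr0 //; lia.
elim: n => [|n IHn]; first by rewrite !big_nat1.
have ->: (3 * n.+1 = (3 * n).+3)%N by lia.
rewrite (big_nat_recr (3 * n).+3) // (big_nat_recr (3 * n).+2) //.
rewrite (big_nat_recr (3 * n).+1) //= IHn.
rewrite [RHS]big_nat_recr //= (F0 (3 * n).+1) ?(F0 (3 * n).+2) ?addr0; try lia.
by congr (_ + F _); lia.
Qed.

Lemma section3D r f g : U r (f + g) = U r f + U r g.
Proof. by []. Qed.

Lemma section3Mn r f k : U r (f *+ k) = U r f *+ k.
Proof. by apply/fpsP=> n; rewrite ?(section3E, expand3E) !coefsMn. Qed.

(** A factor in [X ^ 3] preserves residues of exponents modulo 3, so it leaves the section with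
    [X ^ 3] replaced by [X]. *)
Lemma section3_expandM r f g : (r < 3)%N -> U r (V g * f) = g * U r f.
Proof.
move=> lt_r3; apply/fpsP=> n; rewrite section3E !coefsM.
rewrite (sum_multiples3 (F := fun i => V g i * f (3 * n + r - i)%N)) //; last first.
  by move=> i; rewrite /= => /negPf->; rewrite mul0r.
apply: eq_bigr => i _ /=; rewrite dvdn_mulr // mulKn //; congr (_ * f _).
have := ltn_ord i; lia.
Qed.

Lemma section3_eq (f g : fps) :
  U 0 f = U 0 g -> U 1 f = U 1 g -> U 2 f = U 2 g -> f = g.
Proof.
move=> /fpsP eq0 /fpsP eq1 /fpsP eq2; apply/fpsP=> n.
have := ltn_pmod n (isT : 0 < 3)%N; have := divn_eq n 3; rewrite mulnC.
case: (n %% 3)%N => [|[|[|//]]] -> _; [exact: eq0 | exact: eq1 | exact: eq2].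
Qed.

Lemma section3_expand r f : (r < 3)%N -> U r (V f) = if r == 0 then f else 0.
Proof.
move=> lt_r3; apply/fpsP=> n; rewrite section3E expand3E dvdn_addr ?dvdn_mulr //.
case: r lt_r3 => [|[|[|//]]] _ //=; by rewrite addn0 mulKn.
Qed.

Lemma section3_1 r : U r.+1 1 = 0.
Proof. by apply/fpsP=> n; rewrite section3E addnS. Qed.

Fact expand3_zmod : zmod_morphism V.
Proof.
move=> f g; apply/fpsP=> n; rewrite !(coefsD, coefsN, expand3E).
by case: ifP; rewrite ?subr0.
Qed.

Fact expand3_monoid : monoid_morphism V.
Proof.
split=> [|f g].
  apply/fpsP=> n; rewrite ?(section3E, expand3E) !coefs1; case: ifP => [/dvdnP[k ->] | ].
    by rewrite mulnK // muln_eq0 orbF.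
  by case: n.
(* Both sides have the sections [f * g], 0 and 0. *)
by apply: section3_eq; rewrite section3_expandM // !section3_expand //= mulr0.
Qed.

HB.instance Definition _ := GRing.isZmodMorphism.Build fps fps V expand3_zmod.
HB.instance Definition _ := GRing.isMonoidMorphism.Build fps fps V expand3_monoid.

Lemma expand3X : V X = X ^+ 3.
Proof.
apply/fpsP=> n; rewrite coefsXn expand3E; case: ifP => [/dvdnP[k ->] | ].
  by rewrite mulnK //= -(@eqn_pmul2r 3).
by case: eqP => // ->.
Qed.

Lemma section3_Xn r f k : (k <= r)%N -> U r (X ^+ k * f) = U (r - k) f.
Proof.
move=> le_kr; apply/fpsP=> n; rewrite ?(section3E, expand3E) coefsXnM ifT; last by lia.
by congr (f _); lia.
Qed.

(** The shift wraps around to residue [r + 3 - k], and the borrow contributes the factor [X]. *)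
Lemma section3_XnS r f k : (r < k)%N -> (k <= r + 3)%N ->
  U r (X ^+ k * f) = X * U (r + 3 - k) f.
Proof.
move=> lt_rk le_k; apply/fpsP=> n; rewrite ?(section3E, expand3E) coefsXnM coefsXM.
case: n => [|n]; first by rewrite ifF //; lia.
by rewrite ifT; [congr (f _); lia | lia].
Qed.

Lemma dissection3 f : f = V (U 0 f) + X * V (U 1 f) + X ^+ 2 * V (U 2 f).
Proof.
rewrite -[X in _ + X * _ + _]expr1.
apply: section3_eq; rewrite !section3D.
- by rewrite !section3_XnS //= !section3_expand //= !mulr0 !addr0.
- by rewrite section3_Xn // section3_XnS // !section3_expand //= mulr0 addr0 add0r.
- by rewrite !section3_Xn // !section3_expand //= !add0r.
Qed.

Lemma section3_V3 (f g h : fps) r : (r < 3)%N ->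
  U r (V f + X * V g + X ^+ 2 * V h) =
  if r == 0 then f else if r == 1 then g else h.
Proof.
move=> lt_r3; rewrite -[X in _ + X * _ + _]expr1 !section3D.
case: r lt_r3 => [|[|[|//]]] _ /=.
- by rewrite !section3_XnS //= !section3_expand //= !mulr0 !addr0.
- by rewrite section3_Xn // section3_XnS // !section3_expand //= mulr0 addr0 add0r.
- by rewrite !section3_Xn // !section3_expand //= !add0r.
Qed.

Lemma section3_dissected r f f0 f1 f2 : (r < 3)%N ->
  f = V f0 + X * V f1 + X ^+ 2 * V f2 ->
  U r f = if r == 0 then f0 else if r == 1 then f1 else f2.
Proof. by move=> lt_r3 ->; apply: section3_V3. Qed.

(* The product of the three series f(w X), w ^ 3 = 1, as a series in X ^ 3. *)
Definition norm3 (f : fps) : fps :=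
  U 0 f ^+ 3 + X * U 1 f ^+ 3 + X ^+ 2 * U 2 f ^+ 3
  - X * U 0 f * U 1 f * U 2 f *+ 3.

(** Sections of a product are sums of products of sections, with a factor [X] when the residues add
    up to 3 or more; the rest is a polynomial identity. *)
Lemma norm3M f g : norm3 (f * g) = norm3 f * norm3 g.
Proof.
have fgE : f * g =
    V (U 0 f * U 0 g + X * (U 1 f * U 2 g + U 2 f * U 1 g))
  + X * V (U 0 f * U 1 g + U 1 f * U 0 g + X * (U 2 f * U 2 g))
  + X ^+ 2 * V (U 0 f * U 2 g + U 1 f * U 1 g + U 2 f * U 0 g).
  rewrite {1}(dissection3 f) {1}(dissection3 g) !(rmorphD, rmorphM) /= expand3X.
  ring.
rewrite /norm3 !(section3_dissected _ fgE) //=.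
ring.
Qed.

(** Coefficient [i < n] of a section is coefficient [3 * i + r < 3 * n] of the series. *)
Lemma norm3_eqmodX n f g : eqmodX (3 * n) f g -> eqmodX n (norm3 f) (norm3 g).
Proof.
move=> eq_fg; have eqU r : (r < 3)%N -> eqmodX n (U r f) (U r g).
  by move=> lt_r3 i lt_in; apply: eq_fg; lia.
have eqM := eqmodXM (eqmodX_refl _).
apply: eqmodXD; last first.
  move=> i lt_in; rewrite !coefsN !coefsMn; congr (- (_ *+ _)); move: i lt_in.
  by apply: eqmodXM (eqU 2 _) => //; apply: eqmodXM (eqU 1 _) => //; apply/eqM/eqU.
by apply: eqmodXD; [apply: eqmodXD; last apply: eqM | apply: eqM];
  apply/eqmodXX/eqU.
Qed.

Lemma norm3_1 : norm3 1 = 1.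
Proof.
rewrite /norm3 !section3_1 (_ : U 0 1 = 1); last first.
  by apply/fpsP=> n; rewrite ?(section3E, expand3E) !coefs1 addn0 muln_eq0.
ring.
Qed.

End Dissection.

(** * Theta series *)

Lemma dvd3_sqr m : (3 %| m ^ 2) = (3 %| m).
Proof. by rewrite Euclid_dvdX // andbT. Qed.

Section Theta.
Local Open Scope ring_scope.
Variable R : comNzRingType.
Local Notation fps := (fps R).
Local Notation X := (fpsX R).
Local Notation V := (@expand3 R).
Local Notation U := (@section3 R).

(** For [s] equal to 1 or -1 and [a = 1], these truncate the products of all [1 + X ^ k] and of all
    [1 - X ^ k]; the parameter lets both be treated at once. *)
Definition qprod (s : fps) a b : fps := \prod_(a <= k < b) (1 + s * X ^+ k).
Local Notation D := (qprod 1).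
Local Notation E := (qprod (-1)).

Lemma qprod_recr s a b : (a <= b)%N -> qprod s a b.+1 = qprod s a b * (1 + s * X ^+ b).
Proof. exact: big_nat_recr. Qed.

Lemma qprod_recl s a b : (a < b)%N -> qprod s a b = (1 + s * X ^+ a) * qprod s a.+1 b.
Proof. exact: big_ltn. Qed.

Lemma qprod_nil s a : qprod s a a = 1.
Proof. exact: big_geq. Qed.

Lemma qprod0 s m : (qprod s 1 m) 0 = 1.
Proof.
elim: m => [|[|m] IHm]; rewrite ?qprod_nil //; first by rewrite /qprod big_geq.
rewrite qprod_recr // coefsM0 IHm mul1r exprS mulrCA coefsD coefsM0.
by rewrite mul0r addr0.
Qed.

(* Shanks' finite form of Gauss's identity
   [\sum_(k : int) (-1) ^ k X ^ (k ^ 2) = \prod_k (1 - X ^ k) / (1 + X ^ k)];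
   the sum on the right is divisible by [X ^ n.+1]. *)
Lemma theta_finite n :
  D 1 n.+1 * (1 + (\sum_(i < n) (-1) ^+ i.+1 * X ^+ (i.+1 ^ 2)) *+ 2) =
  E 1 n.+1 + (\sum_(i < n) (-1) ^+ i.+1
                 * (X ^+ (i.+1 * n.+1) * (D 1 i.+1 * E i.+2 n.+1))) *+ 2.
Proof.
elim: n => [|n IHn]; first by rewrite !big_ord0 !qprod_nil mul1r.
set x := X ^+ n.+1.
(* Going from [n] to [n.+1] multiplies each summand by [1 + x], up to a difference of consecutive
   values of [u] that telescopes. *)
pose u i : fps := (-1) ^+ i * (X ^+ (i.+1 * n.+1) * (D 1 i.+1 * E i.+1 n.+1)).
have step (i : 'I_n) :
    (-1) ^+ i.+1 * (X ^+ (i.+1 * n.+2) * (D 1 i.+1 * E i.+2 n.+2))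
  = (1 + x) * ((-1) ^+ i.+1 * (X ^+ (i.+1 * n.+1) * (D 1 i.+1 * E i.+2 n.+1)))
    - (u i.+1 - u i).
  have lt_in := ltn_ord i; rewrite /u (qprod_recl _ (_ : i.+1 < n.+1)%N) //.
  rewrite (qprod_recr _ (_ : i.+2 <= n.+1)%N) // (qprod_recr _ (_ : 1 <= i.+1)%N) //.
  have -> : X ^+ (i.+1 * n.+2) = X ^+ i.+1 * X ^+ (i.+1 * n.+1) by rewrite mulnS exprD.
  have -> : X ^+ (i.+2 * n.+1) = x * X ^+ (i.+1 * n.+1) by rewrite mulSn exprD.
  rewrite -/x [(-1) ^+ i.+1]exprS.
  move: (X ^+ (i.+1 * n.+1)) (X ^+ i.+1) x (D _ _) (E _ _) ((-1) ^+ i) => *; ring.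
rewrite [in RHS]big_ord_recr /= (eq_bigr _ (fun i _ => step i)).
rewrite sumrB -mulr_sumr -(big_mkord xpredT (fun i => u i.+1 - u i)) telescope_sumr //.
rewrite big_ord_recr /= !(qprod_recr _ (_ : 1 <= n.+1)%N) // -/x.
rewrite /u !mul1n !qprod_nil mulnn (mulnS _ n.+1) exprD mulnn expr0 (exprS _ n) -/x.
set S := \sum_(i < n) _ in IHn *; set T := \sum_(i < n) _ in IHn *.
(* Of the boundary terms, [u 0] turns the new factor [1 - x] of the [E] product into [1 + x], while
   [u n] and the last summand together give the new square term. *)
transitivity ((1 + x) * (D 1 n.+1 * (1 + S *+ 2))
  - D 1 n.+1 * (1 + x) * (-1) ^+ n * X ^+ (n.+1 ^ 2) *+ 2); first by ring.
by rewrite IHn; ring.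
Qed.

(** This is the S of the overview: only positive roots count, and a root [i.+1] of [n] satisfies
    [i < n]. *)
Definition squares : fps :=
  Fps (fun n => \sum_(i < n) (-1) ^+ i.+1 * (n == (i.+1 ^ 2)%N)%:R).

Definition theta : fps := 1 + squares *+ 2.

Lemma coefs_signM k (f : fps) n : ((-1) ^+ k * f) n = (-1) ^+ k * f n.
Proof. by elim: k => [|k IHk]; rewrite ?mul1r // !exprS -!mulrA !mulN1r coefsN IHk. Qed.

Lemma squares_eqmodX m :
  eqmodX m.+1 squares (\sum_(i < m) (-1) ^+ i.+1 * X ^+ (i.+1 ^ 2)).
Proof.
move=> n le_nm; rewrite coefs_sum (eq_bigr _ (fun i _ => coefs_signM _ _ _)).
rewrite (eq_bigr _ (fun i _ => congr1 _ (coefsXn _ _ _))) /=.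
rewrite -!(big_mkord xpredT (fun i => (-1) ^+ i.+1 * (n == (i.+1 ^ 2)%N)%:R)).
rewrite [RHS](big_cat_nat _ (n := n)) //=.
rewrite [X in _ = _ + X]big_nat [X in _ = _ + X]big1 ?addr0 //.
by move=> i /andP[le_ni _]; rewrite (_ : n == _ = false) ?mulr0 //; nia.
Qed.

(** Gauss's product with the denominator cleared: every correction term of the finite form has a
    factor [X ^ (i.+1 * n.+1)], hence vanishes at this precision. *)
Lemma theta_qprod m : eqmodX m (theta * D 1 m) (E 1 m).
Proof.
case: m => // m; rewrite mulrC -[X in eqmodX _ _ X]addr0.
apply: (@eqmodX_trans _ _ _ (D 1 m.+1 *
  (1 + (\sum_(i < m) (-1) ^+ i.+1 * X ^+ (i.+1 ^ 2)) *+ 2))).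
  apply: eqmodXM => //; apply: eqmodXD => // i lt_im.
  by rewrite !coefsMn (squares_eqmodX lt_im).
rewrite theta_finite; apply: eqmodXD => // n lt_nm.
rewrite coefsMn coefs_sum big1 ?mul0rn // => i _.
by rewrite coefs_signM (@eqmodXnM _ m.+1) ?mulr0 // leq_pmull.
Qed.

Lemma squares_sqr m : squares (m.+1 ^ 2)%N = (-1) ^+ m.+1.
Proof.
have lt_m : (m < m.+1 ^ 2)%N by nia.
rewrite /= (bigD1 (Ordinal lt_m)) //= eqxx mulr1 big1 ?addr0 // => i.
rewrite -val_eqE /= => ne_im; rewrite (_ : _ == _ = false) ?mulr0 //.
by rewrite eqn_exp2r // eqSS eq_sym (negPf ne_im).
Qed.

Lemma squares_or n : squares n = 0 \/ exists m, n = (m.+1 ^ 2)%N.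
Proof.
case: (pselect (exists m, n = (m.+1 ^ 2)%N)) => [|no_m]; [by right | left].
by rewrite /= big1 // => i _; case: eqP => [e|]; [case: no_m; exists i | rewrite mulr0].
Qed.

Lemma squares0 : squares 0 = 0.
Proof. by rewrite /= big_ord0. Qed.

(** A square divisible by 3 is [9 * j ^ 2], and its sign is kept because [3 * j] and [j] have the
    same parity. *)
Lemma section3_squares : U 0 squares = V squares.
Proof.
apply/fpsP=> n; rewrite section3E expand3E addn0.
case: ifP => [/dvdnP[k ->] | n3].
  rewrite mulnK // (mulnC k) mulnA.
  have [sq0|[m ->]] := squares_or k; last first.
    have -> : (3 * 3 * m.+1 ^ 2 = (3 * m).+2.+1 ^ 2)%N by nia.
    rewrite !squares_sqr -signr_odd -[RHS]signr_odd.
    by rewrite (_ : (3 * m).+3 = 3 * m.+1)%N ?oddM //; lia.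
  have [->|[m e]] := squares_or (3 * 3 * k); first by rewrite sq0.
   have /dvdnP[j je] : (3 %| m.+1)%N.
    by rewrite -dvd3_sqr -e; lia.
  case: j je => [|j] je; first by lia.
  move: sq0; have -> : k = (j.+1 ^ 2)%N by rewrite je in e; nia.
  by rewrite squares_sqr => /eqP; rewrite signr_eq0.
have [->//|[m e]] := squares_or (3 * n).
have /dvdnP[j je] : (3 %| m.+1)%N by rewrite -dvd3_sqr -e dvdn_mulr.
have : (3 %| n)%N.
  by have -> : n = (3 * j ^ 2)%N; [rewrite je in e; nia | rewrite dvdn_mulr].
by rewrite n3.
Qed.

(** Squares are 0 or 1 modulo 3. *)
Lemma section3_2_squares : U 2 squares = 0.
Proof.
apply/fpsP=> n; rewrite section3E; have [->//|[m e]] := squares_or (3 * n + 2).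
have := congr1 (modn^~ 3) e; rewrite /= -modnXm; have := ltn_pmod m.+1 (isT : 0 < 3)%N.
by case: (m.+1 %% 3)%N => [|[|[|//]]] _; rewrite mulnC modnMDl.
Qed.

Lemma section3_theta : U 0 theta = V theta.
Proof.
rewrite /theta section3D section3Mn section3_squares rmorphD rmorphMn rmorph1.
by congr (_ + _); apply/fpsP=> n; rewrite section3E !coefs1 addn0 muln_eq0.
Qed.

Lemma section3_2_theta : U 2 theta = 0.
Proof. by rewrite section3D section3Mn section3_2_squares section3_1 mul0rn addr0. Qed.

(** The norm fixes a factor [1 + s * X ^ k] with [k] prime to 3 and sends the one with [k = 3 * j]
    to [(1 + s * X ^ j) ^ 3]. The factor [V (qprod s 1 m.+1)] restores the missing factors of
    exponent divisible by 3. *)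
Lemma qprod_norm3 (s : fps) m : s ^+ 3 = s -> V s = s ->
  norm3 (qprod s 1 (3 * m).+1) * V (qprod s 1 m.+1) =
  qprod s 1 m.+1 ^+ 3 * qprod s 1 (3 * m).+1.
Proof.
move=> s3 Vs.
have norm_dissected f a b c : f = V a + X * V b + X ^+ 2 * V c ->
    norm3 f = a ^+ 3 + X * b ^+ 3 + X ^+ 2 * c ^+ 3 - X * a * b * c *+ 3.
  by move=> fE; rewrite /norm3 !(section3_dissected _ fE).
have X3 k : X ^+ (3 * k) = (X ^+ k) ^+ 3 by rewrite mulnC exprM.
have VsX k : V (s * X ^+ k) = s * X ^+ (3 * k).
  by rewrite rmorphM rmorphXn /= expand3X Vs -exprM.
have factor0 k : norm3 (1 + s * X ^+ (3 * k)) = (1 + s * X ^+ k) ^+ 3.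
  rewrite (norm_dissected _ (1 + s * X ^+ k) 0 0); first by ring.
  by rewrite rmorphD /= VsX rmorph0 rmorph1; ring.
have factor1 k : norm3 (1 + s * X ^+ (3 * k).+1) = 1 + s * X ^+ (3 * k).+1.
  rewrite (norm_dissected _ 1 (s * X ^+ k) 0); last first.
    by rewrite VsX rmorph0 rmorph1 (exprS X (3 * k)); ring.
  by rewrite exprMn s3 (exprS X (3 * k)) X3; ring.
have factor2 k : norm3 (1 + s * X ^+ (3 * k).+2) = 1 + s * X ^+ (3 * k).+2.
  rewrite (norm_dissected _ 1 0 (s * X ^+ k)); last first.
    by rewrite VsX rmorph0 rmorph1 (exprS X (3 * k).+1) (exprS X (3 * k)); ring.
  by rewrite exprMn s3 (exprS X (3 * k).+1) (exprS X (3 * k)) X3; ring.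
elim: m => [|m IHm]; first by rewrite muln0 !qprod_nil norm3_1 rmorph1; ring.
have e3 : (3 * m.+1 = (3 * m).+3)%N by lia.
have VE : V (1 + s * X ^+ m.+1) = 1 + s * X ^+ (3 * m.+1).
  by rewrite rmorphD /= VsX rmorph1.
have factor0' := factor0 m.+1; rewrite e3 in VE factor0' *.
rewrite !(qprod_recr s (_ : 1 <= (_).+1)%N) // !norm3M factor1 factor2 factor0'.
rewrite rmorphM /= VE.
transitivity (norm3 (qprod s 1 (3 * m).+1) * V (qprod s 1 m.+1) *
  ((1 + s * X ^+ (3 * m).+1) * (1 + s * X ^+ (3 * m).+2) * (1 + s * X ^+ (3 * m).+3) *
  (1 + s * X ^+ m.+1) ^+ 3)); first by ring.
by rewrite IHm; ring.
Qed.

End Theta.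

(** * Powers of the theta series modulo 9 and 16 *)

(** Descent: if 3 divides a sum of two squares, it divides both roots, so 9 can be divided out. For
    [k = 0] this makes 3 divide [m]. Single squares are the case [b = 0]. *)
Lemma sum2sqr_neq k m a b :
  ~~ (3 %| m) -> a ^ 2 + b ^ 2 <> 3 ^ (2 * k + 1) * m.
Proof.
move=> m3; elim: k a b => [|k IHk] a b e.
all: have /andP[/dvdnP[a' a3] /dvdnP[b' b3]] : (3 %| a) && (3 %| b).
1,3: have : 3 %| a ^ 2 + b ^ 2 by rewrite e ?addn1 ?expnS -?mulnA dvdn_mulr.
1,2: rewrite /dvdn -modnDm -(modnXm _ _ a) -(modnXm _ _ b).
1,2: have := ltn_pmod a (isT : 0 < 3); have := ltn_pmod b (isT : 0 < 3).
1,2: by case: (a %% 3) => [|[|[|//]]]; case: (b %% 3) => [|[|[|//]]].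
- by move/negP: m3; apply; apply/dvdnP; exists (a' ^ 2 + b' ^ 2); rewrite a3 b3 in e; nia.
apply: (IHk a' b'); apply/eqP; rewrite -(@eqn_pmul2l 9) //; apply/eqP.
rewrite (_ : 2 * k.+1 + 1 = (2 * k + 1).+2) in e; last by lia.
by rewrite a3 b3 !expnS in e *; lia.
Qed.

Section ThetaPowers.
Local Open Scope ring_scope.
Variable R : comNzRingType.
Local Notation fps := (fps R).
Local Notation X := (fpsX R).
Local Notation V := (@expand3 R).
Local Notation U := (@section3 R).
Local Notation D := (qprod (1 : fps)).
Local Notation E := (qprod (-1 : fps)).
Local Notation theta := (theta R).

Lemma expand3_eqmodX n (f g : fps) : eqmodX n f g -> eqmodX n (V f) (V g).
Proof.
move=> eq_fg i lt_in; rewrite !expand3E; case: ifP => // _.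
by apply: eq_fg; apply: leq_ltn_trans lt_in; apply: leq_div.
Qed.

(** The product identity holds for both [D] and [E], hence for their quotient theta; it is checked
    modulo each [X ^ m] after multiplication by the denominators. *)
Lemma norm3_theta : norm3 theta * V theta = theta ^+ 4.
Proof.
apply: eqmodX_all => m.
have D_norm := @qprod_norm3 R 1 m (expr1n _ _) (rmorph1 _).
have E_norm : norm3 (E 1 (3 * m).+1) * V (E 1 m.+1) = E 1 m.+1 ^+ 3 * E 1 (3 * m).+1.
  by apply: qprod_norm3; [ring | rewrite rmorphN rmorph1].
have th n k : (k <= n)%N -> eqmodX k (theta * D 1 n) (E 1 n).
  by move=> le_kn; apply: eqmodXW (@theta_qprod R n).
apply: (@eqmodX_cancel _ _ (D 1 m.+1 ^+ 3 * D 1 (3 * m).+1)).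
  by rewrite coefsM0 coefs_exp0 ?qprod0 // mulr1.
rewrite -{1}D_norm.
apply: (@eqmodX_trans _ _ _ (E 1 m.+1 ^+ 3 * E 1 (3 * m).+1)).
  rewrite -E_norm mulrACA -norm3M -rmorphM /= ![_ * theta]mulrC.
  (* The norm divides the precision by three, so its argument takes the products up to [3 * m]. *)
  apply: eqmodXM; first by apply/norm3_eqmodX/th.
  exact/expand3_eqmodX/th.
have -> : D 1 m.+1 ^+ 3 * D 1 (3 * m).+1 * theta ^+ 4 =
  (theta * D 1 m.+1) ^+ 3 * (theta * D 1 (3 * m).+1) by ring.
by apply/eqmodX_sym/eqmodXM; [apply/eqmodXX/th | apply: th; lia].
Qed.

(** * The inverse cube of theta modulo 9 *)

Section Mod9.
Hypothesis char9 : 9%:R = 0 :> R.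

Let fps_char9 : 9%:R = 0 :> fps. Proof. exact: fps_natr0. Qed.

(** Turns an equality modulo 9 into an exact identity with explicit quotient [h], which [ring] can
    check. *)
Let add9M (f g h : fps) : f = g + 9%:R * h -> f = g.
Proof. by rewrite fps_char9 mul0r addr0. Qed.

Lemma qprod_exp9 (s : fps) m : s ^+ 3 = s -> V s = s ->
  qprod s 1 m.+1 ^+ 9 = V (qprod s 1 m.+1) ^+ 3.
Proof.
move=> s3 Vs; elim: m => [|m IHm]; first by rewrite qprod_nil rmorph1 !expr1n.
rewrite qprod_recr // exprMn IHm rmorphM exprMn; congr (_ * _).
rewrite rmorphD rmorphM rmorphXn /= expand3X Vs rmorph1 -exprM mulnC exprM -{2}s3 -exprMn.
set y := s * X ^+ m.+1.
(* The argument is [((1 + y) ^ 9 - (1 + y ^ 3) ^ 3) / 9]. *)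
apply: (@add9M _ _ (y + y ^+ 2 *+ 4 + y ^+ 3 *+ 9 + y ^+ 4 *+ 14
  + y ^+ 5 *+ 14 + y ^+ 6 *+ 9 + y ^+ 7 *+ 4 + y ^+ 8)).
ring.
Qed.

Lemma theta_exp9 : theta ^+ 9 = V theta ^+ 3.
Proof.
apply: eqmodX_all => m.
have th : eqmodX m (theta * D 1 m.+1) (E 1 m.+1).
  exact: eqmodXW (@theta_qprod R m.+1).
apply: (@eqmodX_cancel _ _ (D 1 m.+1 ^+ 9)); first by rewrite coefs_exp0 ?qprod0.
apply: (@eqmodX_trans _ _ _ (E 1 m.+1 ^+ 9)).
  by rewrite -exprMn [_ * theta]mulrC; apply: eqmodXX.
rewrite !qprod_exp9 ?rmorphN ?rmorph1 //; try ring.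
by rewrite -exprMn -rmorphM [_ * theta]mulrC; apply/eqmodX_sym/eqmodXX/expand3_eqmodX.
Qed.

Variable P : fps.
Hypothesis P_theta : P * theta ^+ 3 = 1.

Let c := U 1 theta.

Let theta_dissection : theta = V (V theta) + X * V c.
Proof.
by rewrite {1}(dissection3 theta) section3_theta section3_2_theta rmorph0 mulr0 addr0.
Qed.

Let norm3_thetaE : norm3 theta = V theta ^+ 3 + X * c ^+ 3.
Proof. by rewrite /norm3 section3_theta section3_2_theta -/c; ring. Qed.

Let section3_theta2 : U 0 (theta ^+ 2) = V theta ^+ 2.
Proof.
apply: (@section3_dissected _ 0 _ _ (V theta * c *+ 2) (c ^+ 2)) => //.
by rewrite {1}theta_dissection rmorphMn !(rmorphXn, rmorphM) /=; ring.
Qed.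

(** With [a = V theta], the section of the binomial expansion is [a ^ 5 + 10 X a ^ 2 c ^ 3], and 10
    is 1 modulo 9. *)
Let section3_theta5 : U 0 (theta ^+ 5) = V theta ^+ 2 * norm3 theta.
Proof.
set a := V theta.
apply: (@add9M _ _ (X * a ^+ 2 * c ^+ 3)); rewrite norm3_thetaE -/a.
have -> : a ^+ 2 * (a ^+ 3 + X * c ^+ 3) + 9%:R * (X * a ^+ 2 * c ^+ 3) =
  a ^+ 5 + X * a ^+ 2 * c ^+ 3 *+ 10 by ring.
apply: (@section3_dissected _ 0 _ _ (a ^+ 4 * c *+ 5 + X * a * c ^+ 4 *+ 5)
  (a ^+ 3 * c ^+ 2 *+ 10 + X * c ^+ 5)) => //.
rewrite {1}theta_dissection -/a !(rmorphD, rmorphMn) !(rmorphM, rmorphXn) /= expand3X.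
ring.
Qed.

(** Here the middle coefficient is 20, which is 2 modulo 9 and completes the square. *)
Let section3_theta6 : U 0 (theta ^+ 6) = norm3 theta ^+ 2.
Proof.
set a := V theta.
apply: (@add9M _ _ (X * a ^+ 3 * c ^+ 3 *+ 2)); rewrite norm3_thetaE -/a.
have -> : (a ^+ 3 + X * c ^+ 3) ^+ 2 + 9%:R * (X * a ^+ 3 * c ^+ 3 *+ 2) =
  a ^+ 6 + X * a ^+ 3 * c ^+ 3 *+ 20 + X ^+ 2 * c ^+ 6 by ring.
apply: (@section3_dissected _ 0 _ _ (a ^+ 5 * c *+ 6 + X * a ^+ 2 * c ^+ 4 *+ 15)
  (a ^+ 4 * c ^+ 2 *+ 15 + X * a * c ^+ 5 *+ 6)) => //.
rewrite {1}theta_dissection -/a !(rmorphD, rmorphMn) !(rmorphM, rmorphXn) /= expand3X.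
ring.
Qed.

(** Since [P = theta ^ 6 / V theta ^ 3], its section is [norm3 theta ^ 2 / theta ^ 3], and
    [norm3 theta = theta ^ 4 / V theta]. *)
Lemma section3_inv_theta3 : U 0 P * V theta ^+ 2 = theta ^+ 5.
Proof.
have eqP : theta ^+ 3 * U 0 P = norm3 theta ^+ 2.
  rewrite -section3_theta6 -section3_expandM // rmorphXn /= -theta_exp9; congr (U _ _).
  by rewrite -[RHS]mulr1 -P_theta; ring.
transitivity (P * (norm3 theta * V theta) ^+ 2).
  by rewrite exprMn -eqP -[LHS]mul1r -P_theta; ring.
by rewrite norm3_theta -[RHS]mul1r -P_theta; ring.
Qed.

Lemma section3_iter2_inv_theta3 : U 0 (U 0 P) = V theta * theta ^+ 2.
Proof.
have eqP : theta ^+ 2 * U 0 (U 0 P) = V theta * theta ^+ 4.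
  rewrite -section3_expandM // rmorphXn /= mulrC section3_inv_theta3.
  by rewrite section3_theta5 -norm3_theta; ring.
transitivity (P * theta * (theta ^+ 2 * U 0 (U 0 P))).
  by rewrite -[LHS]mul1r -P_theta; ring.
by rewrite eqP -[RHS]mul1r -P_theta; ring.
Qed.

(** From the second iterate on, the sections alternate between [V theta * theta ^ 2] and
    [V theta ^ 2 * theta]. *)
Lemma section3_iter_inv_theta3 k :
  iter (2 * k + 3) (U 0) P = V theta ^+ 2 * theta.
Proof.
have step2 : U 0 (V theta * theta ^+ 2) = V theta ^+ 2 * theta.
  by rewrite section3_expandM // section3_theta2 mulrC.
elim: k => [|k IHk]; first by rewrite muln0 add0n /= section3_iter2_inv_theta3 step2.
rewrite (_ : 2 * k.+1 + 3 = (2 * k + 3).+2)%N; last by lia.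
by rewrite 2!iterS IHk -{1}rmorphXn section3_expandM // section3_theta mulrC step2.
Qed.

Lemma iter_section3E k (f : fps) n : iter k (U 0) f n = f (3 ^ k * n)%N.
Proof.
elim: k n => [|k IHk] n; first by rewrite mul1n.
by rewrite iterS section3E IHk addn0 mulnA expnSr.
Qed.

Lemma inv_theta3_mod9 k n : P (3 ^ (2 * k + 3) * (3 * n + 2))%N = 0.
Proof.
rewrite -iter_section3E section3_iter_inv_theta3 -section3E -rmorphXn.
by rewrite section3_expandM // section3_2_theta mulr0.
Qed.

End Mod9.

(** * The inverse cube of theta modulo 16 *)

Section Mod16.
Hypothesis char16 : 16%:R = 0 :> R.
Variable P : fps.
Hypothesis P_theta : P * theta ^+ 3 = 1.

Lemma inv_theta3_mod16 : P = 1 - squares R *+ 6 + squares R ^+ 2 *+ 8.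
Proof.
set S := squares R.
(* The quadratic is the binomial series of [(1 + 2 S) ^ -3] modulo 16, where terms of degree at
   least 3 vanish. *)
have inv : theta ^+ 3 * (1 - S *+ 6 + S ^+ 2 *+ 8) =
    1 + 16%:R * (- S ^+ 2 - S ^+ 3 + S ^+ 4 *+ 3 + S ^+ 5 *+ 4).
  by rewrite /theta -/S; ring.
rewrite fps_natr0 // mul0r addr0 in inv.
by rewrite -[RHS]mul1r -{1}P_theta -mulrA inv mulr1.
Qed.

Lemma inv_theta3_coef_mod16 k m :
  ~~ (3 %| m)%N -> P (3 ^ (2 * k + 1) * m)%N = 0.
Proof.
move=> m3; set n := (_ * m)%N; have n_neq a b := @sum2sqr_neq k m a b m3.
have n_gt0 : (0 < n)%N by rewrite muln_gt0 expn_gt0; case: (m) m3.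
have sqr_n : squares R n = 0.
  have [//|[a e]] := squares_or R n.
  by case: (n_neq a.+1 0); rewrite addn0 -e.
have sqr2_n : (squares R ^+ 2) n = 0.
  rewrite expr2 coefsM big1 // => i _.
  have [->|[a ea]] := squares_or R i; first by rewrite mul0r.
  have [->|[b eb]] := squares_or R (n - i); first by rewrite mulr0.
  by case: (n_neq a.+1 b.+1); rewrite -ea -eb subnKC // -ltnS.
rewrite inv_theta3_mod16 !coefsD coefsN !coefsMn sqr_n sqr2_n coefs1.
by rewrite !mul0rn oppr0 !addr0; case: (n) n_gt0.
Qed.

End Mod16.
End ThetaPowers.

(** * Generating function of overpartition triples *)

(* When [b] is false the part [x] may not be overlined, as is the case for the
   tail of an overpartition whose first part is [x]. *)
Definition overpartition_le x b (s : seq (nat * bool)) :=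
  [&& overpartition s, all (fun y => y.1 <= x) s & b || ((x, true) \notin s)].

Lemma overpartition_cons y c s :
  overpartition ((y, c) :: s) = (0 < y) && overpartition_le y false s.
Proof.
rewrite /overpartition_le /overpartition /= (path_sortedE (rev_trans leq_trans)).
have -> : all (geq y) (unzip1 s) = all (fun z => z.1 <= y) s by rewrite all_map.
have -> : all (fun z => (y == z.1) ==> ~~ z.2) s = ((y, true) \notin s).
  apply/allP/idP => [s_y | s_y [z d] /= s_zd]; first by apply/negP=> /s_y; rewrite eqxx.
  by apply/implyP=> /eqP yz; apply: contraNN s_y => d1; rewrite yz -d1.
by rewrite -!andbA; do !bool_congr.
Qed.

Lemma overpartition_le_cons x b y c s :
  overpartition_le x b ((y, c) :: s) =
  [&& 0 < y <= x, overpartition_le y false s & b || ((y, c) != (x, true))].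
Proof.
rewrite {1}/overpartition_le overpartition_cons /= inE negb_or eq_sym.
case: (boolP (overpartition_le y false s)) => [|_]; last by rewrite !andbF.
case/and3P=> _ s_y y_s; rewrite andTb -!andbA; congr (_ && _).
case: leqP => //= le_yx; have -> : all (fun z => z.1 <= x) s.
  by apply: sub_all s_y => z; move/leq_trans; apply.
case: b => //=; case: (eqVneq (y, c) (x, true)) => //= _.
apply: contraNN y_s => x_s; have /= le_xy := allP s_y _ x_s.
by have -> : y = x by apply/eqP; rewrite eqn_leq le_yx.
Qed.

Definition overpartitions_le x b n : seq (seq (nat * bool)) :=
  [seq s <- [seq to_list t | t : bounded_list n]
    | overpartition_le x b s & weight s == n].

Lemma mem_overpartitions_le x b n s :
  (s \in overpartitions_le x b n) = overpartition_le x b s && (weight s == n).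
Proof.
rewrite mem_filter andb_idr // => /andP[/and3P[s_ok _ _] /eqP wt_s].
have [t <-] := to_list_surj s_ok (eq_leq wt_s).
by apply: map_f; rewrite mem_enum.
Qed.

Lemma overpartitions_le_uniq x b n : uniq (overpartitions_le x b n).
Proof. by rewrite filter_uniq // map_inj_uniq ?enum_uniq //; apply: to_list_inj. Qed.

Lemma size_overpartitions_le0 n : size (overpartitions_le 0 true n) = (n == 0).
Proof.
have -> : size (overpartitions_le 0 true n) =
    size (if n == 0 then [:: [::]] else [::] : seq (seq (nat * bool))).
  apply/perm_size/uniq_perm; first exact: overpartitions_le_uniq.
    by case: ifP.
  move=> [|[y c] s]; rewrite mem_overpartitions_le.
    by rewrite /weight /= eq_sym; case: ifP.
  by rewrite overpartition_le_cons; case: y => [|y]; case: ifP.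
by case: eqP.
Qed.

(** Either all parts are at most [x], or the first part is [x.+1]; then the tail has no overlined
    [x.+1], and [b.+1] counts the flags allowed for the first part. *)
Lemma size_overpartitions_leS x b n :
  size (overpartitions_le x.+1 b n) =
  size (overpartitions_le x true n) +
  (if x < n then size (overpartitions_le x.+1 false (n - x.+1)) * b.+1 else 0).
Proof.
pose add c := if x < n
  then map (cons (x.+1, c)) (overpartitions_le x.+1 false (n - x.+1)) else [::].
have mem_add c s : s \in add c =
    if s is (y, d) :: s'
    then [&& y == x.+1, d == c, overpartition_le x.+1 false s' & weight s == n]
    else false.
  rewrite /add; case: (ltnP x n) => [lt_xn | le_nx]; last first.
    rewrite in_nil; case: s => // -[y d] s; apply/esym/and4P=> -[/eqP-> _ _].
    by rewrite /weight /=; lia.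
  apply/mapP/idP=> [[s' ] | ]; last first.
    case: s => // -[y d] s /and4P[/eqP-> /eqP-> s_ok wt_s]; exists s => //.
    by rewrite mem_overpartitions_le s_ok /=; move: wt_s; rewrite /weight /=; lia.
  rewrite mem_overpartitions_le => /andP[s_ok wt_s] ->; rewrite !eqxx s_ok /=.
  by move: wt_s; rewrite /weight /=; lia.
have add_uniq c : uniq (add c).
  rewrite /add; case: ifP => // _.
  by rewrite map_inj_uniq ?overpartitions_le_uniq // => ? ? [].
have -> : size (overpartitions_le x.+1 b n) =
    size (overpartitions_le x true n ++ add false ++ (if b then add true else [::])).
  apply/perm_size/uniq_perm; first exact: overpartitions_le_uniq.
    rewrite cat_uniq overpartitions_le_uniq cat_uniq add_uniq /=.
    have -> : uniq (if b then add true else [::]) by case: (b).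
    rewrite andbT; apply/andP; split.
      apply/hasPn=> s; rewrite mem_cat => s_add; rewrite /= mem_overpartitions_le.
      have : (s \in add false) || (s \in add true).
        by case/orP: s_add => [->|] //; case: (b) => // ->; rewrite orbT.
      rewrite !mem_add; case: s {s_add} => // -[y d] s.
      by rewrite overpartition_le_cons => /orP[] /and4P[/eqP-> *]; rewrite ltnn andbF.
    apply/hasPn=> s s_add; have : s \in add true by move: s_add; case: (b).
    rewrite /= !mem_add; case: s {s_add} => // -[y d] s.
    by case/and4P=> [_ /eqP-> _ _]; rewrite andbF.
  move=> s; rewrite !mem_cat.
  have -> : (s \in (if b then add true else [::])) = b && (s \in add true).
    by case: (b).
  rewrite !mem_add !mem_overpartitions_le.
  case: s => [|[y d] s]; first by rewrite andbF !orbF /overpartition_le /= orbT.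
  rewrite !overpartition_le_cons.
  case: (weight _ == n); rewrite ?andbF // !andbT.
  rewrite (leq_eqVlt y) ltnS xpair_eqE; case: (eqVneq y x.+1) => [->|ne_yx] /=.
    rewrite ltnn /=; case: (overpartition_le _ _ _); case: (b); case: (d) => //.
  by rewrite andbF !orbF !orbT !andbT.
rewrite !size_cat /add; congr (_ + _).
by case: (x < n); case: (b); rewrite ?size_map ?muln2 ?muln1 ?addn0 ?addnn.
Qed.

(** * Enumeration of pairs by total weight *)

Lemma graded_flatten_uniq (T : eqType) (w : T -> nat) (F : nat -> seq T) r :
  uniq r -> (forall i, uniq (F i)) -> (forall i x, x \in F i -> w x = i) ->
  uniq (flatten (map F r)).
Proof.
move=> r_uniq F_uniq Fw; elim: r r_uniq => //= i r IHr /andP[ri /IHr r_uniq].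
rewrite cat_uniq F_uniq r_uniq andbT; apply/hasPn=> x /flatten_mapP[j rj /Fw wj].
by apply: contraNN ri => /Fw <-; rewrite wj.
Qed.

(** The Cauchy product at the level of lists, so that enumerating pairs multiplies generating
    series. *)
Definition convolution (S T : Type) (F : nat -> seq S) (G : nat -> seq T) n :=
  flatten [seq [seq (s, t) | s <- F i, t <- G (n - i)] | i <- iota 0 n.+1].

Lemma size_convolution S T (F : nat -> seq S) (G : nat -> seq T) n :
  size (convolution F G n) = \sum_(i < n.+1) size (F i) * size (G (n - i)).
Proof.
rewrite size_flatten /shape -map_comp sumnE big_map.
rewrite -[iota _ _]/(index_iota 0 n.+1) big_mkord.
by apply: eq_bigr => i _; rewrite /= size_allpairs.
Qed.

Definition graded_enum (T : eqType) (P : pred T) (w : T -> nat) (F : nat -> seq T) :=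
  (forall n, uniq (F n)) /\ (forall n x, (x \in F n) = P x && (w x == n)).

Lemma convolution_enum (S T : eqType) (P : pred S) (Q : pred T) v w F G :
  graded_enum P v F -> graded_enum Q w G ->
  graded_enum (fun x => P x.1 && Q x.2) (fun x => v x.1 + w x.2) (convolution F G).
Proof.
move=> [F_uniq memF] [G_uniq memG]; split=> [n | n [s t]].
  apply: (@graded_flatten_uniq _ (fun x => v x.1)); first exact: iota_uniq.
    by move=> i; apply: allpairs_uniq => // -[? ?] [? ?] _ _ [-> ->].
  by move=> i _ /allpairsP[[s t] [/= + _ ->]]; rewrite memF => /andP[_ /eqP].
apply/flatten_mapP/andP=> [[i i_n] | [/andP[Ps Qt] /eqP wt]].
  case/allpairsP=> -[s' t'] [/= + + [-> ->]]; rewrite memF memG.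
  move: i_n; rewrite mem_iota ltnS /= => le_in /andP[-> /eqP->] /andP[-> /eqP->].
  by rewrite subnKC.
rewrite /= in Ps Qt wt; exists (v s); first by rewrite mem_iota ltnS -wt leq_addr.
by apply/allpairsP; exists (s, t); rewrite memF memG Ps Qt -wt addKn !eqxx.
Qed.

Definition overpartitions n := overpartitions_le n true n.

Lemma overpartitions_enum : graded_enum overpartition weight overpartitions.
Proof.
split=> [n | n s]; first exact: overpartitions_le_uniq.
rewrite mem_overpartitions_le /overpartition_le /= andbT -andbA; congr (_ && _).
rewrite andb_idl // => /eqP <-; apply/allP=> x; exact: part_weight.
Qed.

Lemma size_overpartitions_le m n :
  n <= m -> size (overpartitions_le m true n) = size (overpartitions n).
Proof.
move/subnK <-; elim: (m - n) => // k IHk.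
by rewrite addSn size_overpartitions_leS ltnNge leq_addl addn0.
Qed.

Section OverpartitionSeries.
Local Open Scope ring_scope.
Variable R : comNzRingType.
Local Notation fps := (fps R).
Local Notation X := (fpsX R).
Local Notation D := (qprod (1 : fps)).
Local Notation E := (qprod (-1 : fps)).

Definition overpartition_le_series x b : fps :=
  Fps (fun n => (size (overpartitions_le x b n))%:R).
Local Notation G := overpartition_le_series.

Lemma overpartition_le_seriesS x b :
  G x.+1 b = G x true + X ^+ x.+1 * G x.+1 false *+ b.+1.
Proof.
apply/fpsP=> n; rewrite coefsD coefsMn coefsXnM /= size_overpartitions_leS natrD.
by congr (_ + _); case: ifP => _; rewrite ?mul0rn // natrM mulr_natr.
Qed.

(** With [x = X ^ m.+1], the recursion gives [G m true = (1 - x) * G m.+1 false] and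
    [G m.+1 true = (1 + x) * G m.+1 false]. *)
Lemma overpartition_le_series_qprod m : G m true * E 1 m.+1 = D 1 m.+1.
Proof.
elim: m => [|m IHm].
  by rewrite !qprod_nil mulr1; apply/fpsP=> n; rewrite /= size_overpartitions_le0.
rewrite !(qprod_recr _ (_ : 1 <= m.+1)%N) // -IHm.
have Gt := overpartition_le_seriesS m true.
have Gf := overpartition_le_seriesS m false; rewrite /= in Gt; rewrite mulr1n in Gf.
have Gm : G m true = G m.+1 false - X ^+ m.+1 * G m.+1 false by rewrite {1}Gf; ring.
by rewrite Gt Gm; ring.
Qed.

Definition overpartition_series : fps := Fps (fun n => (size (overpartitions n))%:R).

(** Modulo [X ^ m] the bound [m] on parts is harmless, so multiplying by [theta * D = E] gives [D]
    back, and [D] cancels. *)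
Lemma overpartition_series_theta : overpartition_series * theta R = 1.
Proof.
apply: eqmodX_all => m; apply: (@eqmodX_cancel _ _ (D 1 m.+1)); first exact: qprod0.
have -> : D 1 m.+1 * (overpartition_series * theta R) =
  overpartition_series * (theta R * D 1 m.+1) by ring.
apply: (@eqmodX_trans _ _ _ (G m true * E 1 m.+1)); last first.
  by rewrite overpartition_le_series_qprod mulr1.
apply: eqmodXM; last exact: eqmodXW (@theta_qprod R m.+1).
by move=> n lt_nm; rewrite /= size_overpartitions_le // ltnW.
Qed.

Lemma p3bar_series n : (p3bar n)%:R = (overpartition_series ^+ 3) n.
Proof.
have [tri_uniq mem_tri] :=
  convolution_enum (convolution_enum overpartitions_enum overpartitions_enum)
    overpartitions_enum.
rewrite (p3barE (tri_uniq n)) => [|[[s t] u]]; last first.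
  by rewrite mem_tri /overpartition_triple /= -!andbA.
rewrite size_convolution natr_sum exprSr coefsM; apply: eq_bigr => i _.
rewrite natrM; congr (_ * _); rewrite size_convolution natr_sum expr2 coefsM.
by apply: eq_bigr => j _; rewrite natrM.
Qed.

End OverpartitionSeries.

(** * The congruence modulo 144 *)

Lemma Zp_natr_eq0 d k : 1 < d -> (k%:R = 0 :> 'Z_d)%R -> d %| k.
Proof.
by move=> d_gt1 /(congr1 val); rewrite /= val_Zp_nat // => /eqP.
Qed.

Theorem theorem3p7 (alpha n : nat) (halpha : 1 <= alpha) :
  p3bar (3 ^ (2 * alpha + 1) * (3 * n + 2)) = 0 %[mod 144].
Proof.
have inv (R : comNzRingType) : (overpartition_series R ^+ 3 * theta R ^+ 3 = 1)%R.
  by rewrite -exprMn overpartition_series_theta expr1n.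
apply/eqP; rewrite mod0n -/(dvdn _ _) -[144]/(9 * 16) Gauss_dvd //; apply/andP; split.
  apply: Zp_natr_eq0 => //; rewrite p3bar_series.
  (* The bound [1 <= alpha] provides the three sections after which the alternation modulo 9 has
     begun. *)
  have -> : 2 * alpha + 1 = 2 * alpha.-1 + 3 by lia.
  by apply: inv_theta3_mod9; rewrite ?inv // pchar_Zp.
apply: Zp_natr_eq0 => //; rewrite p3bar_series.
(* Since [3 * n + 2] is prime to 3, the index has odd 3-adic valuation. *)
apply: inv_theta3_coef_mod16; rewrite ?inv ?pchar_Zp //.
by rewrite dvdn_addr ?dvdn_mulr.
Qed.
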